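(* Let $\Sigma$ be a covariance matrix of full rank $n$. If $\boldsymbol{\mu}$ is an $n$-tuple of umbral polynomials such that $f(\boldsymbol{\mu},\boldsymbol{t})=1+\frac12\boldsymbol{t}\Sigma^{-1}\boldsymbol{t}^T$ and $\boldsymbol{\mu}_{\boldsymbol{x}}$ is an $n$-tuple of umbral polynomials such that $f(\boldsymbol{\mu}_{\boldsymbol{x}},\boldsymbol{t})=1+f(\boldsymbol{\mu},\boldsymbol{t}+\boldsymbol{x})-f(\boldsymbol{\mu},\boldsymbol{x})$, then for all $\boldsymbol{i}\in\mathbb{N}_0^n$ $$H_{\boldsymbol{i}}(\boldsymbol{x},\Sigma)\simeq(-1)^{|\boldsymbol{i}|}(-1\boldsymbol{.}\beta\boldsymbol{.}\boldsymbol{\mu}_{\boldsymbol{x}})^{\boldsymbol{i}},$$ i.e. $H_{\boldsymbol{i}}(\boldsymbol{x},\Sigma)=(-1)^{|\boldsymbol{i}|}E[(-1\boldsymbol{.}\beta\boldsymbol{.}\boldsymbol{\mu}_{\boldsymbol{x}})^{\boldsymbol{i}}]$.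
   Context: Vectors $\boldsymbol{x}=(x_1,\dots,x_n)$ and $\boldsymbol{t}=(t_1,\dots,t_n)$ are row vectors. Multivariate Hermite polynomials: $H_{\boldsymbol{i}}(\boldsymbol{x},\Sigma)=(-1)^{|\boldsymbol{i}|}\,D^{(\boldsymbol{i})}_{\boldsymbol{x}}\phi(\boldsymbol{x};\boldsymbol{0},\Sigma)/\phi(\boldsymbol{x};\boldsymbol{0},\Sigma)$, where $\phi(\boldsymbol{x};\boldsymbol{0},\Sigma)$ is the density of the multivariate Gaussian with mean $\boldsymbol{0}$ and covariance matrix $\Sigma$, $|\boldsymbol{i}|=i_1+\cdots+i_n$ and $D^{(\boldsymbol{i})}_{\boldsymbol{x}}=\partial^{|\boldsymbol{i}|}/\partial x_1^{i_1}\cdots\partial x_n^{i_n}$. Umbral calculus: $R$ is the real or complex field, $A$ a set of symbols (umbrae), $E$ a linear functional on $R[A]$ with $E[1]=1$ and $E[\alpha^i\gamma^j\cdots]=E[\alpha^i]E[\gamma^j]\cdots$ for distinct umbrae; the components of $\boldsymbol{x}$ are treated as constants for $E$ (moments may depend polynomially on $\boldsymbol{x}$). $p\simeq q$ means $E[p]=E[q]$. An $n$-tuple $\boldsymbol{\mu}$ of umbral polynomials (elements of $R[A]$) has moments $g_{\boldsymbol{i}}=E[\boldsymbol{\mu}^{\boldsymbol{i}}]$, $\boldsymbol{\mu}^{\boldsymbol{i}}=\mu_1^{i_1}\cdots\mu_n^{i_n}$, and generating function $f(\boldsymbol{\mu},\boldsymbol{t})=1+\sum_{\boldsymbol{i}\ne\boldsymbol{0}}g_{\boldsymbol{i}}\boldsymbol{t}^{\boldsymbol{i}}/\boldsymbol{i}!$,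 $\boldsymbol{i}!=i_1!\cdots i_n!$. A partition $\boldsymbol{\lambda}\vdash\boldsymbol{i}$ of a multi-index is a matrix of nonnegative integers with $n$ rows, no zero column, columns in lexicographic order, and $r$-th row sum $i_r$; $l(\boldsymbol{\lambda})$ is its number of columns; if its distinct columns $\boldsymbol{\lambda}_1,\boldsymbol{\lambda}_2,\dots$ have multiplicities $r_1,r_2,\dots$, then $\mathfrak{m}(\boldsymbol{\lambda})!=r_1!r_2!\cdots$, $\boldsymbol{\lambda}!=\prod_j(\boldsymbol{\lambda}_j!)^{r_j}$. For an $n$-tuple $\boldsymbol{\eta}$ with moments $g_{\boldsymbol{i}}$, put $g_{\boldsymbol{\lambda}}=\prod_jg_{\boldsymbol{\lambda}_j}^{r_j}$; the auxiliary umbra $-1\boldsymbol{.}\beta\boldsymbol{.}\boldsymbol{\eta}$ ($\beta$ denotes the Bell umbra) is the symbolic $n$-tuple with moments $$E[(-1\boldsymbol{.}\beta\boldsymbol{.}\boldsymbol{\eta})^{\boldsymbol{i}}]=\sum_{\boldsymbol{\lambda}\vdash\boldsymbol{i}}\frac{\boldsymbol{i}!}{\mathfrak{m}(\boldsymbol{\lambda})!\,\boldsymbol{\lambda}!}(-1)^{l(\boldsymbol{\lambda})}g_{\boldsymbol{\lambda}}.$$ *)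

(* Defs.v *)
From HB Require Import structures.
From mathcomp Require Import all_boot all_order all_algebra all_field.
From mathcomp Require Import all_classical all_reals.
From mathcomp Require Import topology normedtype sequences derive exp trigo.
(* The notations of multinomials cannot coexist with those of analysis. *)
From mathcomp.multinomials Require Import -(notations) monalg.
From mathcomp.multinomials Require Import -(notations) mpoly.

Set Implicit Arguments.
Unset Strict Implicit.
Unset Printing Implicit Defensive.

Import Order.TTheory GRing.Theory Num.Theory.
Import numFieldNormedType.Exports.

Local Open Scope ring_scope.

(* {mpoly T[n]} is T[x_1, ..., x_n]; {umbral C[A]} is C[A], the polynomials in
   the (possibly infinitely many) symbols of A with coefficients in C. *)
Notation "{ 'mpoly' T [ n ] }" := (mpoly.mpoly n T)
  (at level 0, T, n at level 2, format "{ 'mpoly'  T [ n ] }") : type_scope.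
Notation "{ 'umbral' C [ A ] }" := (monalg.malg (monalg.cmonom A) C)
  (at level 0, C, A at level 2, format "{ 'umbral'  C [ A ] }") : type_scope.

Definition mfact (n : nat) (i : multinom n) : nat := (\prod_(r < n) (i r)`!)%N.

Definition covariance_matrix (R : realType) (n : nat) (Sigma : 'M[R]_n) : Prop :=
  Sigma^T = Sigma /\ forall u : 'rV[R]_n, 0 <= (u *m Sigma *m u^T) 0 0.

Definition gauss_density (R : realType) (n : nat) (m : 'rV[R]_n)
    (Sigma : 'M[R]_n) (x : 'rV[R]_n) : R :=
  (Num.sqrt ((2 * pi) ^+ n * \det Sigma))^-1 *
  expR (- 2^-1 * ((x - m) *m invmx Sigma *m (x - m)^T) 0 0).

Definition partial (R : realType) (n : nat) (r : 'I_n) (f : 'rV[R]_n -> R) :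
    'rV[R]_n -> R :=
  fun x => 'D_(delta_mx 0 r) f x.

(* d^|i| / (dx_1^{i_1} ... dx_n^{i_n}), with d/dx_1 applied last *)
Definition mpartial (R : realType) (n : nat) (i : multinom n)
    (f : 'rV[R]_n -> R) : 'rV[R]_n -> R :=
  foldr (fun r g => iter (i r) (partial r) g) f (enum 'I_n).

Definition hermite (R : realType) (n : nat) (i : multinom n) (x : 'rV[R]_n)
    (Sigma : 'M[R]_n) : R :=
  (-1) ^+ mdeg i * mpartial i (gauss_density 0 Sigma) x /
  gauss_density 0 Sigma x.

(* The tuple order on [multinom] of the library is degree-based, hence the
   explicit lexicographic comparison. *)
Definition lexi_le (n : nat) (c d : multinom n) : bool :=
  ((tval (multinom_val c) : seqlexi nat) <= (tval (multinom_val d) : seqlexi nat))%O.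

(* A partition is the sequence of the columns of its matrix. *)
Definition is_mpart (n : nat) (i : multinom n) (l : seq (multinom n)) : bool :=
  [&& sorted (@lexi_le n) l, mnm0 \notin l
    & [forall r : 'I_n, (\sum_(c <- l) c r)%N == i r]].

(* A partition of i has at most |i| columns, each of degree at most |i|;
   mem_mparts and uniq_mparts state that nothing is missed or repeated. *)
Definition mparts (n : nat) (i : multinom n) : seq (seq (multinom n)) :=
  [seq l <- [seq [seq bmnm c | c <- tval t]
             | k <- iota 0 (mdeg i).+1,
               t <- enum {: k.-tuple (bmultinom n (mdeg i).+1)}]
   | is_mpart i l].

Lemma is_mpart_mdeg (n : nat) (i : multinom n) (l : seq (multinom n)) :
  is_mpart i l -> mdeg i = (\sum_(c <- l) mdeg c)%N.
Proof.
case/and3P=> _ _ /forallP h.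
rewrite mdegE (eq_bigr (fun r => \sum_(c <- l) c r)%N); last first.
  by move=> r _; rewrite (eqP (h r)).
by rewrite exchange_big /=; apply: eq_bigr => c _; rewrite mdegE.
Qed.

Lemma mem_mparts (n : nat) (i : multinom n) (l : seq (multinom n)) :
  (l \in mparts i) = is_mpart i l.
Proof.
rewrite mem_filter; case hl: (is_mpart i l); rewrite ?andTb ?andFb //.
have hd := is_mpart_mdeg hl.
have l0 : mnm0 \notin l by case/and3P: hl.
have hc c : c \in l -> (mdeg c < (mdeg i).+1)%N.
  by move=> cl; rewrite ltnS hd (big_rem c) //= leq_addr.
have hs : (size l < (mdeg i).+1)%N.
  rewrite ltnS hd -sum1_size big_seq [X in (_ <= X)%N]big_seq.
  apply: leq_sum => c cl; rewrite lt0n mdeg_eq0.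
  by apply: contraNneq l0 => <-.
pose s : seq (bmultinom n (mdeg i).+1) := [seq insubd bm0 c | c <- l].
have sz : size s == size l by rewrite size_map.
apply/allpairsPdep; exists (size l), (Tuple sz); split.
- by rewrite mem_iota.
- by rewrite mem_enum.
- rewrite /= /s -map_comp -[LHS]map_id; apply/eq_in_map => c cl /=.
  by rewrite -[bmnm _]/(val _) val_insubd hc.
Qed.

Lemma uniq_mparts (n : nat) (i : multinom n) : uniq (mparts i).
Proof.
apply: filter_uniq; apply: allpairs_uniq_dep.
- exact: iota_uniq.
- by move=> k _; apply: enum_uniq.
move=> [k t] [k' t'] _ _ /= h.
have e : k = k' by have := congr1 size h; rewrite !size_map !size_tuple.
subst k'; congr existT; apply/val_inj.
by apply: (inj_map (@val_inj _ _ (bmultinom n (mdeg i).+1))).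
Qed.

Definition umbra (C : nzRingType) (A : choiceType) (a : A) : {umbral C[A]} :=
  monalg.mkmalgU (monalg.ucm a) 1.

Definition is_evaluation (C : comNzRingType) (A : choiceType)
    (E : {umbral C[A]} -> C) : Prop :=
  E 1 = 1 /\
  forall (s : seq A) (k : A -> nat), uniq s ->
    E (\prod_(a <- s) umbra C a ^+ k a) = \prod_(a <- s) E (umbra C a ^+ k a).

Definition moment (C : comNzRingType) (A : choiceType)
    (E : {umbral C[A]} -> C) (n : nat) (eta : 'I_n -> {umbral C[A]})
    (i : multinom n) : C :=
  E (\prod_(r < n) eta r ^+ i r).

(* E[(-1.beta.eta)^i], for g the moments of eta *)
Definition neg_bell_moment (K : fieldType) (n : nat)
    (g : multinom n -> {mpoly K[n]}) (i : multinom n) : {mpoly K[n]} :=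
  \sum_(l <- mparts i)
    ((mfact i)%:R /
     ((\prod_(c <- undup l) (count_mem c l)`!)%:R *
      (\prod_(c <- undup l) mfact c ^ count_mem c l)%:R) : K) *:
    ((-1) ^+ size l * \prod_(c <- undup l) g c ^+ count_mem c l).

(* The coefficients in K[x] of the generating function, as a power series in t *)
Definition genfun_coef (K : fieldType) (A : choiceType) (n : nat)
    (E : {umbral {mpoly K[n]}[A]} -> {mpoly K[n]})
    (eta : 'I_n -> {umbral {mpoly K[n]}[A]}) (i : multinom n) : {mpoly K[n]} :=
  if i == mnm0 then 1 else ((mfact i)%:R^-1 : K) *: moment E eta i.

(* [s i m] is the coefficient of t^i x^m of s in K[[x]][[t]]. *)
Definition xtseries (K : fieldType) (n : nat) : Type :=
  multinom n -> multinom n -> K.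

(* Polynomials in x and t are elements of K[x][t]: the outer variables are t. *)
Definition poly_xtseries (K : fieldType) (n : nat)
    (p : {mpoly {mpoly K[n]}[n]}) : xtseries K n :=
  fun i m => mcoeff m (mcoeff i p).

Definition tvars (K : fieldType) (n : nat) : 'rV[{mpoly {mpoly K[n]}[n]}]_n :=
  \row_r mpolyX _ (mnm1 r).

Definition xvars (K : fieldType) (n : nat) : 'rV[{mpoly {mpoly K[n]}[n]}]_n :=
  \row_r mpolyC n (mpolyX K (mnm1 r)).

(* f(eta, y), for y in K[x][t]^n without constant terms in (x, t). The infinite
   sum over j can then be cut at |j| <= |i| + |m|: every monomial t^a x^b
   of c y^j satisfies |j| <= |a| + |b|, for all c in K[x]. *)
Definition genfun (K : fieldType) (A : choiceType) (n : nat)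
    (E : {umbral {mpoly K[n]}[A]} -> {mpoly K[n]})
    (eta : 'I_n -> {umbral {mpoly K[n]}[A]})
    (y : 'rV[{mpoly {mpoly K[n]}[n]}]_n) : xtseries K n :=
  fun i m => poly_xtseries
    (\sum_(j : bmultinom n (mdeg i + mdeg m).+1)
       genfun_coef E eta j *: \prod_(r < n) y 0 r ^+ (j : multinom n) r) i m.

Definition real_const (R : realType) (K : fieldExtType R) (n : nat) (a : R) :
    {mpoly {mpoly K[n]}[n]} :=
  mpolyC n (mpolyC n a%:A).

(* Main.v *)
(* Put Q = Sigma^-1. The hypotheses say that f(mu_x, t) - 1 is the polynomial
   t Q x^T + t Q t^T / 2, and i! times the sum over the partitions of i of
   prod_c (-g_c / c!)^{m_c} / m_c! is a multivariate complete Bell polynomial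
   B_i in the moments g of mu_x. Counting the columns of a partition with
   weight c_r and removing one of them yields
     B_{j+e_r} = - (x Q)_r B_j - sum_s Q_rs j_s B_{j-e_s},
   where only columns of degree 1 and 2 contribute. By induction on |j|,
     d B_j / d x_s = - sum_r Q_rs j_r B_{j-e_r},
   so B_{j+e_r} phi = d (B_j phi) / d x_r for the Gaussian density phi, whence
   D^(i) phi = B_i phi. *)
Require Import Defs.
From HB Require Import structures.
From mathcomp Require Import all_boot all_order all_algebra all_field.
From mathcomp Require Import all_classical all_reals.
From mathcomp Require Import topology normedtype sequences derive exp trigo.
From mathcomp Require Import realfun.
From mathcomp Require Import zify ring.
From mathcomp Require Import polyrcf.
From mathcomp.multinomials Require Import -(notations) monalg.
From mathcomp.multinomials Require Import -(notations) mpoly.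

Set Implicit Arguments.
Unset Strict Implicit.
Unset Printing Implicit Defensive.

Import Order.TTheory GRing.Theory Num.Theory.
Import numFieldNormedType.Exports.
Local Open Scope ring_scope.

Notation "0" := (@mnm0 _) : multi_scope.
Notation "'U_(' n )" := (mnm1 n) : multi_scope.
Notation "m1 + m2" := (mnm_add m1 m2) : multi_scope.
Notation "m1 - m2" := (mnm_sub m1 m2) : multi_scope.
Notation "m1 <= m2" := (lem m1 m2) : multi_scope.
Delimit Scope multi_scope with MM.

(** * Lexicographic order and removal of a column from a partition *)

Lemma lexi_le_total n : total (@lexi_le n).
Proof. by move=> c d; apply: (@le_total _ (seqlexi nat)). Qed.

Lemma lexi_le_trans n : transitive (@lexi_le n).
Proof. by move=> c d e; apply: (@le_trans _ (seqlexi nat)). Qed.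

Lemma lexi_le_anti n : antisymmetric (@lexi_le n).
Proof.
by move=> c d /(@le_anti _ (seqlexi nat)) h; apply/val_inj/val_inj.
Qed.

(** Sorting restores the canonical order, so the result depends only on the multiset of columns. *)
Definition mpart_add n (c : multinom n) (l : seq (multinom n)) :=
  sort (@lexi_le n) (c :: l).

(** Inserting one copy of [c] and removing one copy are mutually inverse, because a sorted sequence
    is determined by its multiset of columns. *)
Lemma perm_mparts_mpart_add n (i c : multinom n) : c != 0%MM -> (c <= i)%MM ->
  perm_eq [seq l <- mparts i | c \in l]
          [seq mpart_add c l | l <- mparts (i - c)%MM].
Proof.
move=> c0 ci; apply: uniq_perm.
- exact/filter_uniq/uniq_mparts.
- rewrite map_inj_in_uniq ?uniq_mparts // => l l'.
  rewrite !mem_mparts => /and3P[sl _ _] /and3P[sl' _ _] e.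
  apply: (sorted_eq (@lexi_le_trans n) (@lexi_le_anti n)) => //.
  rewrite -(perm_cons c) -(perm_sort (@lexi_le n)) -/(mpart_add c l) e.
  by rewrite perm_sort.
move=> l; rewrite mem_filter mem_mparts.
apply/andP/mapP => [[cl /and3P[sl l0 /forallP hl]]|[l' + ->]].
- exists (rem c l); last first.
    apply: (sorted_eq (@lexi_le_trans n) (@lexi_le_anti n)) => //.
      exact/sort_sorted/lexi_le_total.
    by rewrite perm_sym perm_sort perm_sym perm_to_rem.
  rewrite mem_mparts; apply/and3P; split.
  + apply: (subseq_sorted (@lexi_le_trans n) _ sl); exact: rem_subseq.
  + by apply: contra l0; apply: mem_rem.
  + apply/forallP => r; apply/eqP.
    by rewrite mnmBE -(eqP (hl r)) [in RHS](big_rem c) //= addKn.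
- rewrite mem_mparts => /and3P[sl' l0 /forallP hl]; split.
    by rewrite mem_sort mem_head.
  apply/and3P; split.
  + exact/sort_sorted/lexi_le_total.
  + by rewrite mem_sort inE negb_or eq_sym c0.
  + apply/forallP => r; rewrite (perm_big (c :: l')) /=; last first.
      by rewrite perm_sort.
    by rewrite big_cons (eqP (hl r)) mnmBE subnKC // (mnm_lepP ci).
Qed.

(** * Weighted sums over partitions *)

Section BellSum.
Variables (F : numFieldType) (n : nat) (w : multinom n -> F).

Definition part_weight (l : seq (multinom n)) : F :=
  \prod_(c <- undup l) (w c ^+ count_mem c l / (count_mem c l)`!%:R).

(** This is the coefficient of t^i in exp(\sum_{c <> 0} w_c t^c): a column c of multiplicity m
    contributes the divided power w_c^m / m!. *)
Definition bell_sum (i : multinom n) : F := \sum_(l <- mparts i) part_weight l.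

(** A column absent from [l] contributes w^0 / 0! = 1, so weights of different partitions can be
    compared over a common index set. *)
Lemma part_weight_supset (s l : seq (multinom n)) : uniq s -> {subset l <= s} ->
  part_weight l = \prod_(c <- s) (w c ^+ count_mem c l / (count_mem c l)`!%:R).
Proof.
move=> us ls; rewrite (bigID (mem l)) /= [X in _ * X]big1 ?mulr1; last first.
  by move=> c /count_memPn ->; rewrite expr0 fact0 divr1.
rewrite -big_filter; apply: perm_big; apply: uniq_perm.
- exact: undup_uniq.
- exact: filter_uniq.
- move=> c; rewrite mem_undup mem_filter; case cl: (c \in l) => //=.
  by rewrite ls.
Qed.

Lemma part_weight_perm (l l' : seq (multinom n)) :
  perm_eq l l' -> part_weight l = part_weight l'.
Proof.
move=> ll'; rewrite (part_weight_supset (undup_uniq l')); last first.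
  by move=> c; rewrite mem_undup (perm_mem ll').
by apply: eq_bigr => c _; rewrite (permP ll').
Qed.

(** With m the multiplicity of [c] in [l], this is the rule (m+1) w^(m+1) / (m+1)! = w (w^m / m!)
    for divided powers. *)
Lemma part_weight_cons (c : multinom n) (l : seq (multinom n)) :
  (count_mem c (c :: l))%:R * part_weight (c :: l) = w c * part_weight l.
Proof.
have us := undup_uniq (c :: l).
have cs : c \in undup (c :: l) by rewrite mem_undup mem_head.
rewrite (part_weight_supset (l := l) us); last first.
  by move=> d dl; rewrite mem_undup inE dl orbT.
rewrite /part_weight !(bigD1_seq c cs us) /= eqxx add1n !mulrA; congr (_ * _).
  rewrite factS natrM exprS.
  have fk : ((count_mem c l)`!%:R : F) != 0 by rewrite pnatr_eq0 -lt0n fact_gt0.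
  by field; rewrite fk nat1r pnatr_eq0.
by apply: eq_bigr => d dc; rewrite eq_sym (negPf dc) add0n.
Qed.

(* i_r counts the columns of a partition of i with weights c_r; removing one
   copy of c from a partition of i leaves a partition of i - c. *)
Lemma bell_sum_rec (i : multinom n) (r : 'I_n) (S : seq (multinom n)) :
  uniq S -> (forall c, (c <= i)%MM -> c r != 0%N -> w c != 0 -> c \in S) ->
  (i r)%:R * bell_sum i =
  \sum_(c <- S | (c <= i)%MM) (c r)%:R * w c * bell_sum (i - c)%MM.
Proof.
move=> uS hS.
have le_i l c : l \in mparts i -> c \in l -> (c <= i)%MM.
  rewrite mem_mparts => /and3P[_ _ /forallP hl] cl; apply/mnm_lepP => s.
  by rewrite -(eqP (hl s)) (big_rem c) //= leq_addr.
have expand l : l \in mparts i ->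
    (i r)%:R * part_weight l =
    \sum_(c <- S | c \in l) (c r)%:R * ((count_mem c l)%:R * part_weight l).
  move=> li; transitivity
    (\sum_(c <- undup l) (c r)%:R * ((count_mem c l)%:R * part_weight l)).
    move: (li); rewrite mem_mparts => /and3P[_ _ /forallP hl].
    rewrite -(eqP (hl r)) -big_undup_iterop_count natr_sum big_distrl /=.
    apply: eq_bigr => c _; rewrite mulrA -natrM; congr (_%:R * _).
    by rewrite Monoid.iteropE iter_addn_0.
  (* A column of [l] outside [S] has c_r = 0 or w_c = 0. In the second case its multiplicity is
     positive, so the power of w_c vanishes. *)
  rewrite [LHS](bigID (mem S)) /= [X in _ + X]big1_seq ?addr0; last first.
    move=> c /andP[cS]; rewrite mem_undup => cl.
    have [->|cr] := eqVneq (c r) 0%N; first by rewrite mul0r.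
    have [wc|wc] := eqVneq (w c) 0; last first.
      by rewrite hS ?(le_i l) in cS.
    rewrite [part_weight l](bigD1_seq c) ?undup_uniq ?mem_undup //= wc.
    have : (0 < count_mem c l)%N by rewrite -has_count has_pred1.
    by case: (count_mem c l) => // k _; rewrite expr0n /= !(mul0r, mulr0).
  rewrite -[LHS]big_filter -[RHS]big_filter; apply: perm_big.
  apply: uniq_perm; rewrite ?filter_uniq ?undup_uniq // => c.
  by rewrite !mem_filter mem_undup andbC.
rewrite /bell_sum big_distrr /= big_seq (eq_bigr _ expand) -big_seq.
rewrite (exchange_big_dep xpredT) //= [RHS]big_mkcond /=.
apply: eq_bigr => c _; case: ifP => ci; last first.
  by rewrite big_seq_cond big1 // => l /andP[li cl]; rewrite (le_i l) in ci.
(* The removal bijection requires a nonzero column; for c = 0 the factor c_r makes both sides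
   vanish. *)
have [->|c0] := eqVneq c 0%MM.
  by rewrite mnm0E !mul0r big1 // => l _; rewrite mul0r.
rewrite -big_filter (perm_big _ (perm_mparts_mpart_add c0 ci)) big_map.
rewrite -mulrA !big_distrr /=; apply: eq_bigr => l _.
rewrite -part_weight_cons; congr (_ * (_ * _)).
  by congr _%:R; apply/permP; rewrite perm_sort.
by apply: part_weight_perm; rewrite perm_sort.
Qed.

Lemma bell_sum0 : bell_sum 0%MM = 1.
Proof.
have -> : bell_sum 0%MM = \sum_(l <- [:: [::]]) part_weight l.
  apply: perm_big; apply: uniq_perm => //; first exact: uniq_mparts.
  move=> l; rewrite mem_mparts inE; apply/idP/eqP => [hl|->].
    have := is_mpart_mdeg hl; case/and3P: hl => _ l0 _; rewrite mdeg0.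
    case: l l0 => // c l; rewrite inE negb_or eq_sym -mdeg_eq0 => /andP[c0 _].
    by rewrite big_cons => /esym/eqP; rewrite addn_eq0 (negPf c0).
  by apply/and3P; split => //; apply/forallP => r; rewrite big_nil mnm0E.
by rewrite big_seq1 /part_weight big_nil.
Qed.

End BellSum.

(** * Bell polynomials attached to a quadratic form *)

Lemma mfact_add1 n (j : multinom n) (r : 'I_n) :
  mfact (j + U_(r))%MM = ((j r).+1 * mfact j)%N.
Proof.
rewrite /mfact (bigD1 r) //= [in RHS](bigD1 r) //= mulnA mnmDE mnm1E eqxx addn1.
rewrite factS; congr (_ * _)%N; apply: eq_bigr => s sr.
by rewrite mnmDE mnm1E eq_sym (negPf sr) addn0.
Qed.

Lemma mfact_gt0 n (j : multinom n) : (0 < mfact j)%N.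
Proof. by rewrite prodn_gt0 // => r; exact: fact_gt0. Qed.

Lemma mnm1D1_eq n (a b r s : 'I_n) :
  (U_(a) + U_(b) == U_(r) + U_(s))%MM =
  (a == r) && (b == s) || (a == s) && (b == r).
Proof.
apply/eqP/orP => [e|[]/andP[/eqP-> /eqP->] //]; last exact: addmC.
have [ar|ar] := eqVneq a r.
  by left; move: e; rewrite ar => /addmI/eqP; rewrite eq_mnm1.
have [as_|as_] := eqVneq a s.
  by right; move: e; rewrite as_ addmC => /addIm/eqP; rewrite eq_mnm1.
have /mnmP/(_ a) := e; rewrite !mnmDE !mnm1E eqxx.
by rewrite [r == a]eq_sym [s == a]eq_sym (negPf ar) (negPf as_).
Qed.

Section QuadraticBell.
Variables (R : numFieldType) (n : nat) (Q : 'M[R]_n).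
Hypothesis symQ : Q^T = Q.

Lemma sym_entry r s : Q r s = Q s r.
Proof. by rewrite -[in LHS]symQ mxE. Qed.

(* The coefficient of t^c in t Q x^T + t Q t^T / 2. *)
Definition quad_coef (x : 'rV[R]_n) (c : multinom n) : R :=
  \sum_(r | U_(r)%MM == c) (x *m Q) 0 r +
  2^-1 * \sum_r \sum_(s | (U_(r) + U_(s))%MM == c) Q r s.

(** This is i! times the coefficient of t^i in exp(- x Q t^T - t Q t^T / 2). For Q = Sigma^-1 it
    turns out to be (-1)^|i| H_i(x, Sigma). *)
Definition quad_bell (i : multinom n) (x : 'rV[R]_n) : R :=
  (mfact i)%:R * bell_sum (fun c => - quad_coef x c) i.

Lemma quad_coef1 x r : quad_coef x U_(r)%MM = (x *m Q) 0 r.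
Proof.
rewrite /quad_coef [X in _ + _ * X]big1 ?mulr0 ?addr0 => [|a _].
  by rewrite (big_pred1 r) // => a; rewrite eq_mnm1.
by rewrite big1 // => b /eqP/(congr1 (@mdeg n)); rewrite mdegD !mdeg1.
Qed.

(** For r <> s the monomial t_r t_s arises from (r, s) and from (s, r), which cancels the 1/2; for r
    = s it arises once. The factor on the left is also the r-th entry of e_r + e_s, the weight with
    which [bell_sum_rec] counts this column. *)
Lemma quad_coef2 x r s :
  (r == s).+1%:R * quad_coef x (U_(r) + U_(s))%MM = Q r s.
Proof.
rewrite /quad_coef big1 ?add0r => [|a /eqP/(congr1 (@mdeg n))]; last first.
  by rewrite mdegD !mdeg1.
under eq_bigr do under eq_bigl do rewrite mnm1D1_eq.
have [<-|rs] := eqVneq r s.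
  rewrite (bigD1 r) //= (big_pred1 r) => [|b]; last by rewrite eqxx /= orbb.
  rewrite big1 => [|a /negPf ar]; last by rewrite big_pred0 // => b; rewrite ar.
  by rewrite addr0 mulrA divff ?mul1r ?pnatr_eq0.
rewrite (bigD1 r) //= (big_pred1 s) => [|b]; last first.
  by rewrite /= eqxx (negPf rs) orbF.
rewrite (bigD1 s) /=; last by rewrite eq_sym.
rewrite (big_pred1 r) => [|b]; last by rewrite /= eqxx [s == r]eq_sym (negPf rs).
rewrite big1 => [|a /andP[/negPf ar /negPf as_]]; last first.
  by rewrite big_pred0 // => b; rewrite ar as_.
by rewrite mul1r addr0 [Q s r]sym_entry; field.
Qed.

(** The form has terms of degree 1 and 2 only. This provides the finite set of columns over which
    [bell_sum_rec] is summed. *)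
Lemma quad_coef_eq0 x (c : multinom n) (r : 'I_n) :
  c r != 0%N -> quad_coef x c != 0 ->
  c \in U_(r)%MM :: [seq (U_(r) + U_(s))%MM | s <- enum 'I_n].
Proof.
move=> cr; apply: contraR; rewrite inE negb_or => /andP[c1 /mapP c2].
rewrite /quad_coef big_pred0 => [|a]; last first.
  apply: contraNF c1 => /eqP e; move: cr; rewrite -e mnm1E.
  by case: (a =P r) => [->|].
rewrite big1 ?mulr0 ?addr0 // => a _; rewrite big_pred0 // => b.
apply/eqP => e; case: c2; move: cr; rewrite -e mnmDE !mnm1E.
case: (a =P r) => [->|_]; first by exists b; rewrite ?mem_enum.
by case: (b =P r) => // -> _; exists a; rewrite ?mem_enum // addmC.
Qed.

Lemma quad_bell0 x : quad_bell 0%MM x = 1.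
Proof.
rewrite /quad_bell bell_sum0 mulr1 /mfact big1 // => r _.
by rewrite mnm0E fact0.
Qed.

Lemma quad_bell_rec (j : multinom n) r x :
  quad_bell (j + U_(r))%MM x = - (x *m Q) 0 r * quad_bell j x -
    \sum_s Q r s * (j s)%:R * quad_bell (j - U_(s))%MM x.
Proof.
pose S := U_(r)%MM :: [seq (U_(r) + U_(s))%MM | s <- enum 'I_n].
have uS : uniq S.
  rewrite /= map_inj_uniq ?enum_uniq ?andbT; last first.
    by move=> s s' /addmI /eqP; rewrite eq_mnm1 => /eqP.
  by apply/mapP => -[s _] /(congr1 (@mdeg n)); rewrite mdegD !mdeg1.
(* The factor j_r + 1 of (j + e_r)! is the multiplier that [bell_sum_rec] needs at the index j +
   e_r. *)
rewrite /quad_bell mfact_add1 mulnC natrM -mulrA.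
have -> : (j r).+1 = (j + U_(r))%MM r by rewrite mnmDE mnm1E eqxx addn1.
rewrite (bell_sum_rec uS) => [|c _ cr wc]; last first.
  by apply: (@quad_coef_eq0 x) => //; rewrite -oppr_eq0.
rewrite big_cons lem_addl addmK big_map big_enum_cond /= quad_coef1.
rewrite mnm1E eqxx mul1r mulrDr mulrCA; congr (_ + _).
rewrite big_distrr -sumrN big_mkcond /=; apply: eq_bigr => s _.
have -> : (U_(r) + U_(s) <= j + U_(r))%MM = (U_(s) <= j)%MM.
  by rewrite addmC; apply/mnm_lepP/mnm_lepP => h k; have := h k;
    rewrite !mnmDE leq_add2r.
(* The sum from [bell_sum_rec] is restricted to e_s <= j. The unrestricted sum agrees with it: where
   the subtraction j - e_s is truncated, the coefficient j_s is 0. *)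
rewrite lep1mP; have [->|js] := eqVneq (j s) 0%N.
  by rewrite mulr0 mul0r oppr0.
have js' : (U_(s) <= j)%MM by rewrite lep1mP.
rewrite -submDA addmK mnmDE !mnm1E eqxx [s == r]eq_sym add1n mulrN quad_coef2.
rewrite -[X in mfact X](submK js') mfact_add1 mnmBE mnm1E eqxx.
rewrite subn1 prednK ?lt0n //.
by rewrite natrM; ring.
Qed.

End QuadraticBell.

(** * Partial derivatives of the Bell polynomials and of the Gaussian *)

(** The difference quotients of [f] along [v] are those of its restriction to the line through [x],
    so partial derivatives reduce to calculus in one variable. *)
Lemma is_derive_line (R : numFieldType) (V W : normedModType R) (f : V -> W)
  (x v : V) (d : W) :
  is_derive (0 : R) (1 : R) (fun h : R => f (h *: v + x)) d -> is_derive x v f d.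
Proof.
have e : (fun h : R => h^-1 *: ((f \o shift x) (h *: v) - f x)) =
    (fun h : R => h^-1 *: (((fun k : R => f (k *: v + x)) \o shift 0) h%:A -
      f (0 *: v + x))).
  by apply/funext => h /=; rewrite addr0 scale0r add0r [_%:A]mulr1.
case; rewrite /derivable /derive -e => h1 h2; exact: DeriveDef.
Qed.

Section GaussDerivatives.
Variables (R : realType) (n : nat) (Q : 'M[R]_n).
Hypothesis symQ : Q^T = Q.

Lemma is_derive_mulmx_entry (x : 'rV[R]_n) r s :
  is_derive x (delta_mx 0 s : 'rV[R]_n) (fun y => (y *m Q) 0 r) (Q r s).
Proof.
apply: is_derive_line.
rewrite (_ : (fun _ => _) = horner ((Q r s) *: 'X + ((x *m Q) 0 r)%:P)).
  by apply: trigger_derive; rewrite derivD derivZ derivX derivC !hornerE.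
apply/funext => h; rewrite mulmxDl -scalemxAl -rowE !mxE !hornerE.
by rewrite mulrC (sym_entry symQ).
Qed.

Lemma is_derive_expR_form (x : 'rV[R]_n) s :
  is_derive x (delta_mx 0 s : 'rV[R]_n)
    (fun y => expR (- 2^-1 * (y *m Q *m y^T) 0 0))
    (- (x *m Q) 0 s * expR (- 2^-1 * (x *m Q *m x^T) 0 0)).
Proof.
apply: is_derive_line.
(* [p] is the exponent at x + h e_s as a polynomial in h. The symmetry of [Q] merges the two cross
   terms into the linear one, whose coefficient is the logarithmic derivative sought. *)
pose p := (- 2^-1 * Q s s) *: 'X^2 - ((x *m Q) 0 s) *: 'X
  + (- 2^-1 * (x *m Q *m x^T) 0 0)%:P.
rewrite (_ : (fun _ => _) = expR \o horner p).
  apply: trigger_derive.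
  rewrite !(derivD, derivN, derivZ, derivXn, derivX, derivC) !hornerE /=.
 by rewrite mulr0 subr0 add0r mulrC.
have e1 (y : 'rV[R]_n) : (y *m (delta_mx 0 s : 'rV[R]_n)^T) 0 0 = y 0 s.
  by rewrite -[y]trmxK -trmx_mul -rowE !mxE.
have e2 : ((delta_mx 0 s : 'rV[R]_n) *m Q *m x^T) 0 0 = (x *m Q) 0 s.
  have -> : (delta_mx 0 s : 'rV[R]_n) *m Q *m x^T = (x *m Q *m (delta_mx 0 s)^T)^T.
    by rewrite !trmx_mul trmxK symQ mulmxA.
  by rewrite mxE e1.
apply/funext => h /=; congr expR.
rewrite linearD linearZ /= !mulmxDl !mulmxDr -!scalemxAl -!scalemxAr.
have mD (A B : 'M[R]_1) : (A + B) 0 0 = A 0 0 + B 0 0 by rewrite mxE.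
have mZ a (A : 'M[R]_1) : (a *: A) 0 0 = a * A 0 0 by rewrite mxE.
rewrite !(mD, mZ, e1, e2) -rowE mxE /p.
by rewrite !(hornerD, hornerN, hornerZ, hornerXn, hornerX, hornerC); field.
Qed.

(** Write j = j' + e_k, differentiate the recurrence for B_{j' + e_k}, and compare with the same
    recurrence applied to each B_{j - e_r}. The induction is strong because the recurrence involves
    both j' and the j' - e_u. *)
Lemma is_derive_quad_bell (j : multinom n) s (x : 'rV[R]_n) :
  is_derive x (delta_mx 0 s : 'rV[R]_n) (quad_bell Q j)
    (- \sum_r Q r s * (j r)%:R * quad_bell Q (j - U_(r))%MM x).
Proof.
have [d] := ubnP (mdeg j); elim: d j => // d IHd j; rewrite ltnS => jd.
have [->|] := eqVneq j 0%MM.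
  rewrite (_ : quad_bell Q 0%MM = cst 1); last first.
    by apply/funext => y; rewrite quad_bell0.
  apply: is_derive_eq; rewrite big1 ?oppr0 // => r _.
  by rewrite mnm0E mulr0 mul0r.
rewrite -mdeg_eq0 mdegE sum_nat_eq0 negb_forall => /existsP[k /= jk].
have [j' ej] : exists j', j = (j' + U_(k))%MM.
  by exists (j - U_(k))%MM; rewrite submK ?lep1mP.
have j'd : (mdeg j' < d)%N by move: jd; rewrite ej mdegD mdeg1 addn1.
have IH u := IHd (j' - U_(u))%MM (leq_ltn_trans (mdegB _ _) j'd).
have {}IHd := IHd _ j'd; have D := is_derive_mulmx_entry x k s.
rewrite {1}ej (_ : quad_bell Q _ = - (fun y => (y *m Q) 0 k) * quad_bell Q j' -
  \sum_u (Q k u * (j' u)%:R) *: quad_bell Q (j' - U_(u))%MM); last first.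
  apply/funext => y; rewrite quad_bell_rec // !fctE fct_sumE /=.
  by congr (_ - _); apply: eq_bigr => u _.
apply: is_derive_eq; rewrite /= !fctE.
set X := (x *m Q) 0 k.
(* Both sides count ordered choices of two distinct units of j', one in position r and one in
   position u. *)
have swap r u : ((j' r) * (j' - U_(r))%MM u = j' u * (j' - U_(u))%MM r)%N.
  rewrite !mnmBE !mnm1E; have [->//|_] := eqVneq r u.
  by rewrite !subn0 mulnC.
(* This is the recurrence for B_{(j' - e_r) + e_k}; the factor j'_r makes it hold also where j' -
   e_r is truncated. *)
have lower r : (j' r)%:R * quad_bell Q (j - U_(r))%MM x =
    - X * ((j' r)%:R * quad_bell Q (j' - U_(r))%MM x) -
    \sum_u (Q k u * (j' u)%:R) * (((j' - U_(u))%MM r)%:R *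
      quad_bell Q (j' - U_(u) - U_(r))%MM x).
  have [j0|jr] := eqVneq (j' r) 0%N.
    rewrite j0 !mul0r mulr0 sub0r big1 ?oppr0 // => u _.
    by rewrite mnmBE j0 sub0n mul0r mulr0.
  have -> : (j - U_(r) = (j' - U_(r)) + U_(k))%MM.
    by rewrite ej [RHS]addmC addmBA ?lep1mP // [in RHS]addmC.
  rewrite quad_bell_rec // mulrBr mulrCA; congr (_ - _).
  rewrite big_distrr /=; apply: eq_bigr => u _.
  rewrite !mulrA [_ * Q k u]mulrC -!mulrA; congr (_ * _).
  by rewrite !mulrA -!natrM swap submDA addmC -submDA.
(* Since j_k = j'_k + 1, the index k contributes one extra Q_ks B_{j'}, which matches the term that
   the product rule obtains from (x Q)_k. *)
have -> : \sum_r Q r s * (j r)%:R * quad_bell Q (j - U_(r))%MM x =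
    Q k s * quad_bell Q j' x +
    \sum_r Q r s * ((j' r)%:R * quad_bell Q (j - U_(r))%MM x).
  rewrite (bigD1 k) //= [in RHS](bigD1 k) //= addrA; congr (_ + _).
    by rewrite ej mnmDE mnm1E eqxx addmK addn1 -nat1r; ring.
  apply: eq_bigr => r /negPf rk.
  have -> : j r = j' r by rewrite ej mnmDE mnm1E [k == r]eq_sym rk addn0.
  by rewrite -mulrA.
rewrite (eq_bigr _ (fun r _ => congr1 ( *%R (Q r s)) (lower r))).
under [X in - (_ + X)]eq_bigr do rewrite mulrBr mulrCA big_distrr /=.
rewrite sumrB -big_distrr /= [X in - (_ + (_ - X))]exchange_big /=.
set S := \sum_(i < n) Q i s * _; set T := \sum_(j0 < n) \sum_(i < n) _.
have -> : \sum_r Q r s * (j' r)%:R * quad_bell Q (j' - U_(r))%MM x = S.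
  by apply: eq_bigr => r _; rewrite -mulrA.
rewrite (_ : \sum_(i < n) _ *: _ = - T); last first.
  rewrite -sumrN; apply: eq_bigr => u _; rewrite scalerN; congr (- _).
  rewrite -[LHS]/(_ * _) big_distrr /=; apply: eq_bigr => r _.
  by ring.
rewrite -![_ *: _]/(_ * _); ring.
Qed.

(** Only the logarithmic derivative of [f] matters: d_r (B_j f) = (d_r B_j - (x Q)_r B_j) f = B_{j +
    e_r} f by the recurrence. *)
Lemma mpartial_expR_form (f : 'rV[R]_n -> R) (i : multinom n) :
  (forall x r, is_derive x (delta_mx 0 r : 'rV[R]_n) f (- (x *m Q) 0 r * f x)) ->
  mpartial i f = (fun x => quad_bell Q i x * f x).
Proof.
move=> df; have step r j : partial r (fun x => quad_bell Q j x * f x) =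
    (fun x => quad_bell Q (j + U_(r))%MM x * f x).
  apply/funext => x; have dB := is_derive_quad_bell j r x; have dfx := df x r.
  rewrite /partial -[fun y => _]/(quad_bell Q j * f) derive_val.
  rewrite -![_ *: _]/(_ * _) quad_bell_rec //.
  under [in RHS]eq_bigr do rewrite (sym_entry symQ).
  by ring.
have iter_step r k j : iter k (partial r) (fun x => quad_bell Q j x * f x) =
    (fun x => quad_bell Q (j + mnm_muln U_(r)%MM k)%MM x * f x).
  elim: k => [|k IHk]; first by rewrite mulm0n addm0.
  by rewrite iterS IHk step mulmSr addmA.
(* Writing i as the sum of the i_r e_r along [enum 'I_n] follows the nesting of the derivatives, so
   an induction on this list applies. *)
rewrite {2}(multinomUE_id i) -big_enum /= /mpartial.
elim: (enum 'I_n) => [|r s IHs] /=.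
  by rewrite big_nil; apply/funext => x; rewrite quad_bell0 mul1r.
by rewrite IHs iter_step big_cons addmC.
Qed.

End GaussDerivatives.

(** * Positivity of the determinant of the covariance matrix *)

(* det (t I + Sigma) is a monic polynomial in t without roots in [0, +oo[. *)
Lemma cov_det_gt0 (R : realType) n (Sigma : 'M[R]_n) :
  covariance_matrix Sigma -> \rank Sigma = n -> 0 < \det Sigma.
Proof.
move=> [_ psd] rk.
have unitS : Sigma \in unitmx by rewrite -row_free_unit /row_free rk.
pose p := char_poly (- Sigma).
have pE t : p.[t] = \det (t%:M + Sigma).
  rewrite /p /char_poly -[LHS]/(horner_eval t _) -det_map_mx.
  congr (\det _).
  apply/matrixP => a b; rewrite !mxE /= /horner_eval !hornerE opprK.
  by case: (a == b); rewrite ?mulr1n ?mulr0n ?hornerE.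
have p_neq0 t : 0 <= t -> p.[t] != 0.
  rewrite le_eqVlt => /predU1P[<-|t0].
    by rewrite pE raddf0 add0r -unitfE -unitmxE.
  (* For t > 0, v (t I + Sigma) = 0 gives t |v|^2 + v Sigma v^T = 0, and both terms are nonnegative,
     so v = 0. *)
  rewrite pE -unitfE -unitmxE -row_free_unit; apply: inj_row_free => v.
  move=> /(congr1 (fun u => (u *m v^T) 0 0)).
  rewrite mulmxDr mul_mx_scalar mulmxDl -scalemxAl mul0mx !mxE => vv.
  have := psd v; rewrite mxE => vSv.
  have vv0 : 0 <= \sum_j v 0 j * v^T j 0.
    by apply: sumr_ge0 => j _; rewrite mxE -expr2 sqr_ge0.
  have : \sum_j v 0 j * v^T j 0 = 0.
    apply/eqP; rewrite eq_le vv0 andbT -(pmulr_rle0 _ t0) -[leRHS]vv.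
    by rewrite lerDl.
  move/psumr_eq0P => v0; apply/rowP => j; rewrite mxE.
  have /eqP := v0 (fun j _ => ltac:(rewrite mxE -expr2; exact: sqr_ge0)) j isT.
  by rewrite mxE -expr2 sqrf_eq0 => /eqP.
have [b b_lc] : exists b, forall t, b <= t -> lead_coef p <= p.[t].
  by apply: poly_pinfty_gt_lc; rewrite (monicP (char_poly_monic _)).
(* If det Sigma = p(0) were nonpositive, the intermediate value theorem would give a root of p
   between 0 and a point where p is at least its leading coefficient 1. *)
rewrite -[Sigma]add0r -(raddf0 (@scalar_mx R n)) -pE ltNge; apply/negP => p0.
have mb : 0 <= Num.max 0 b by rewrite le_max lexx.
have [|t] := @Num.Theory.poly_ivt R p 0 (Num.max 0 b) mb.
  rewrite p0 /= (le_trans _ (b_lc _ _)) ?le_max ?lexx ?orbT //.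
  by rewrite (monicP (char_poly_monic _)).
by move=> /andP[t0 _] pt; have := p_neq0 t t0; rewrite -[_ == _]/(root p t) pt.
Qed.

(** * Coefficients of the generating functions *)

Lemma big_bmultinom_pred1 (V : nmodType) n D (a : multinom n)
  (F : multinom n -> V) :
  \sum_(j : bmultinom n D | a == bmnm j) F (bmnm j) =
  if (mdeg a < D)%N then F a else 0.
Proof.
case: ifP => aD; first by rewrite (big_pred1 (BMultinom aD)) // => j; rewrite eq_sym.
by rewrite big_pred0 // => j; apply: contraFF aD => /eqP ->; exact: bmdeg.
Qed.

Section GenfunQuadratic.
Variables (K : fieldType) (A : choiceType) (n : nat).
Variable E : {umbral {mpoly K[n]}[A]} -> {mpoly K[n]}.
Variables mu mu_x : 'I_n -> {umbral {mpoly K[n]}[A]}.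

(** The cut at degree |i| + |m| keeps the index i, the only one that contributes to t^i. *)
Lemma genfun_tvars (eta : 'I_n -> {umbral {mpoly K[n]}[A]}) i m :
  genfun E eta (tvars K n) i m = mcoeff m (genfun_coef E eta i).
Proof.
rewrite /genfun /poly_xtseries; congr (mcoeff m _).
rewrite -[RHS](@mcoeff_mpoly _ _ (genfun_coef E eta) i (mdeg i + mdeg m).+1);
  last by rewrite ltnS leq_addr.
congr (mcoeff i _); apply: eq_bigr => j _; congr (_ *: _).
by rewrite mpolyXE_id; apply: eq_bigr => r _; rewrite mxE.
Qed.

Variable c : 'I_n -> 'I_n -> K.
Hypothesis muE : forall j, genfun_coef E mu j =
  mpolyC n ((j == 0%MM)%:R + \sum_r \sum_(s | (U_(r) + U_(s))%MM == j) c r s).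

(** Only indices of degree 0 and 2 have nonzero coefficients, and those of degree 2 survive the cut
    exactly when |i| + |m| >= 2. As [y] is arbitrary here, this condition stays in the formula. *)
Lemma genfun_quadratic (y : 'rV[{mpoly {mpoly K[n]}[n]}]_n) (i m : multinom n) :
  genfun E mu y i m = poly_xtseries 1 i m +
    if (1 < mdeg i + mdeg m)%N then
      \sum_r \sum_s c r s * mcoeff m (mcoeff i (y 0 r * y 0 s))
    else 0.
Proof.
pose Y (j : multinom n) := \prod_(r < n) y 0 r ^+ j r.
have YD j k : Y (j + k)%MM = Y j * Y k.
  by rewrite -big_split; apply: eq_bigr => r _; rewrite mnmDE exprD.
have Y1 r : Y U_(r)%MM = y 0 r.
  rewrite /Y (bigD1 r) //= mnm1E eqxx expr1 big1 ?mulr1 // => s sr.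
  by rewrite mnm1E eq_sym (negPf sr) expr0.
have Y0 : Y 0%MM = 1 by rewrite /Y big1 // => r _; rewrite mnm0E expr0.
rewrite /genfun /poly_xtseries.
have -> : \sum_(j : bmultinom n (mdeg i + mdeg m).+1)
    genfun_coef E mu j *: Y j =
    \sum_(j : bmultinom n (mdeg i + mdeg m).+1 | 0%MM == bmnm j) Y (bmnm j) +
    \sum_r \sum_s \sum_(j : bmultinom n (mdeg i + mdeg m).+1 |
       (U_(r) + U_(s))%MM == bmnm j) mpolyC n (c r s) *: Y (bmnm j).
  rewrite [in RHS]big_mkcond.
  under [X in _ = _ + X]eq_bigr => r _ do
    (under eq_bigr do rewrite big_mkcond; rewrite exchange_big).
  rewrite exchange_big -big_split /=; apply: eq_bigr => j _.
  rewrite muE mpolyCD scalerDl; congr (_ + _).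
    by rewrite eq_sym; case: eqP => _; rewrite ?mpolyC0 ?mpolyC1 ?scale0r ?scale1r.
  rewrite raddf_sum scaler_suml; apply: eq_bigr => r _.
  by rewrite raddf_sum scaler_suml big_mkcond.
rewrite big_bmultinom_pred1 mdeg0 Y0 !mcoeffD; congr (_ + _).
under eq_bigr => r _ do under eq_bigr => s _ do
  rewrite (@big_bmultinom_pred1 _ _ _ _ (fun j => mpolyC n (c r s) *: Y j)) mdegD !mdeg1 ltnS.
case: ifP => _; last first.
  by rewrite big1 ?raddf0 // => r _; rewrite big1.
rewrite !raddf_sum /=; apply: eq_bigr => r _.
rewrite !raddf_sum /=; apply: eq_bigr => s _.
by rewrite mcoeffZ mcoeffCM YD !Y1.
Qed.

Hypothesis mu_xE : genfun E mu_x (tvars K n) =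
  poly_xtseries 1 + genfun E mu (tvars K n + xvars K n) -
  genfun E mu (xvars K n).

(** Subtracting the form at x from the form at t + x leaves the pure term in t and the two mixed
    terms. *)
Lemma genfun_coef_shift i : i != 0%MM -> genfun_coef E mu_x i =
  \sum_r \sum_s mpolyC n (c r s) *
    (((U_(r) + U_(s))%MM == i)%:R + (U_(r)%MM == i)%:R * mpolyX K U_(s)%MM +
     (U_(s)%MM == i)%:R * mpolyX K U_(r)%MM).
Proof.
move=> i0; apply/mpolyP => m; rewrite -genfun_tvars mu_xE.
rewrite -[LHS]/(_ + _ - _) !genfun_quadratic.
have -> : poly_xtseries (1 : {mpoly {mpoly K[n]}[n]}) i m = 0.
  by rewrite /poly_xtseries mcoeff1 (negPf i0) mcoeff0.
rewrite !add0r raddf_sum /=; under [RHS]eq_bigr => r _ do rewrite raddf_sum /=.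
under [RHS]eq_bigr => r _ do under eq_bigr => s _ do rewrite mcoeffCM.
case: ifPn => [_|im].
  rewrite -sumrB; apply: eq_bigr => r _.
  rewrite -sumrB; apply: eq_bigr => s _; rewrite -mulrBr -mcoeffB; congr (_ * _).
  rewrite -mcoeffB !mxE; congr (mcoeff m _).
  set tr := mpolyX _ _; set ts := mpolyX _ U_(s)%MM.
  set xr := mpolyX K _; set xs := mpolyX K U_(s)%MM.
  have -> : (tr + mpolyC n xr) * (ts + mpolyC n xs) - mpolyC n xr * mpolyC n xs =
    tr * ts + mpolyC n xs * tr + mpolyC n xr * ts by ring.
  rewrite !mcoeffD !mcoeffCM -mpolyXD !mcoeffX.
  by rewrite ![_ * _%:R]mulrC.
(* Here |i| = 1 and m = 0: the pure term has degree 2 in t, and the mixed terms have no constant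
   coefficient in x. *)
rewrite subr0 big1 // => r _; rewrite big1 // => s _; apply/eqP.
rewrite mulf_eq0; apply/orP; right; apply/eqP.
have di : (0 < mdeg i)%N by rewrite lt0n mdeg_eq0.
have m0 : m = 0%MM by apply/eqP; rewrite -mdeg_eq0; move: im di; lia.
have /negPf -> : (U_(r) + U_(s))%MM != i.
  by apply: contraNneq im => <-; rewrite mdegD !mdeg1.
rewrite !mulr_natl !mcoeffD !mcoeffMn !mcoeffX m0 !mnm1_eq0.
by rewrite !mul0rn !addr0.
Qed.

End GenfunQuadratic.

(** * Evaluation of the umbral moments at a point *)

Section Umbral.
Variables (R : numFieldType) (K : fieldType) (f : {rmorphism R -> K}).
Variables (n : nat) (A : choiceType).
Variable E : {umbral {mpoly K[n]}[A]} -> {mpoly K[n]}.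
Variables (mu mu_x : 'I_n -> {umbral {mpoly K[n]}[A]}) (Q : 'M[R]_n).
Let const (a : R) : {mpoly {mpoly K[n]}[n]} := mpolyC n (mpolyC n (f a)).
Hypothesis symQ : Q^T = Q.
Hypothesis hmu : genfun E mu (tvars K n) =
  poly_xtseries (1 + const 2^-1 *
    (tvars K n *m map_mx const Q *m (tvars K n)^T) 0 0).
Hypothesis hmu_x : genfun E mu_x (tvars K n) =
  poly_xtseries 1 + genfun E mu (tvars K n + xvars K n) -
  genfun E mu (xvars K n).

Lemma genfun_coef_quadratic j : genfun_coef E mu j = mpolyC n ((j == 0%MM)%:R +
  \sum_r \sum_(s | (U_(r) + U_(s))%MM == j) f (2^-1 * Q r s)).
Proof.
apply/mpolyP => m; rewrite -genfun_tvars hmu.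
rewrite /poly_xtseries; congr (mcoeff m _).
have -> : const 2^-1 *
    (tvars K n *m map_mx const Q *m (tvars K n)^T) 0 0 =
    \sum_r \sum_s mpolyC n (mpolyC n (f (2^-1 * Q r s))) *
      mpolyX _ (U_(r) + U_(s))%MM.
  rewrite mxE exchange_big big_distrr /=; apply: eq_bigr => s _.
  rewrite !mxE big_distrl big_distrr /=; apply: eq_bigr => r _.
  by rewrite !mxE rmorphM !mpolyCM mpolyXD /const; ring.
rewrite mcoeffD mcoeff1 mpolyCD mpolyC_nat; congr (_ + _).
rewrite !raddf_sum /=; apply: eq_bigr => r _.
rewrite !raddf_sum /= [RHS]big_mkcond; apply: eq_bigr => s _.
by rewrite mcoeffCM mcoeffX; case: eqP => _; rewrite ?mulr1 ?mulr0.
Qed.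

Lemma meval_moment_shift (x : 'rV[R]_n) i : i != 0%MM ->
  meval (fun r => f (x 0 r)) (moment E mu_x i) =
  f ((mfact i)%:R * quad_coef Q x i).
Proof.
move=> i0.
have fi : (mfact i)%:R != 0 :> R by rewrite pnatr_eq0 -lt0n mfact_gt0.
have fiK : (mfact i)%:R != 0 :> K.
  by rewrite -(rmorph_nat f) fmorph_eq0.
have -> : moment E mu_x i = ((mfact i)%:R : K) *: genfun_coef E mu_x i.
  by rewrite /genfun_coef (negPf i0) scalerA divff // scale1r.
rewrite mevalZ rmorphM rmorph_nat; congr (_ * _).
rewrite (genfun_coef_shift genfun_coef_quadratic hmu_x) //.
transitivity (f (\sum_r \sum_s (2^-1 * Q r s) *
    (((U_(r) + U_(s))%MM == i)%:R + (U_(r)%MM == i)%:R * x 0 s +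
     (U_(s)%MM == i)%:R * x 0 r))).
  rewrite !rmorph_sum; apply: eq_bigr => r _.
  rewrite !rmorph_sum; apply: eq_bigr => s _ /=.
  by rewrite mevalM mevalC !(rmorphM, rmorphD, rmorph_nat) /= !mevalXU.
congr (f _).
(* [T] is one of the two mixed terms; by the symmetry of [Q] the other equals it, and together they
   cancel the 1/2. *)
pose T := \sum_r \sum_s 2^-1 * Q r s * ((U_(r)%MM == i)%:R * x 0 s).
have T1 : T = 2^-1 * \sum_(r | U_(r)%MM == i) (x *m Q) 0 r.
  rewrite big_mkcond big_distrr /=; apply: eq_bigr => r _; rewrite mxE.
  case: eqP => _; last by rewrite mulr0 big1 // => s _; rewrite mul0r mulr0.
  rewrite big_distrr /=; apply: eq_bigr => s _.
  by rewrite (sym_entry symQ); ring.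
have T2 : \sum_r \sum_s 2^-1 * Q r s * ((U_(s)%MM == i)%:R * x 0 r) = T.
  rewrite exchange_big; apply: eq_bigr => r _; apply: eq_bigr => s _.
  by rewrite (sym_entry symQ).
have -> : quad_coef Q x i = \sum_r \sum_s 2^-1 * Q r s *
    ((U_(r) + U_(s))%MM == i)%:R + T + T.
  rewrite /quad_coef addrC -[RHS]addrA; congr (_ + _); last first.
    by rewrite T1; field.
  rewrite big_distrr; apply: eq_bigr => r _.
  rewrite big_mkcond big_distrr; apply: eq_bigr => s _ /=.
  by case: eqP => _; rewrite ?mulr1 ?mulr0.
rewrite -{2}T2 -!big_split; apply: eq_bigr => r _.
by rewrite -!big_split; apply: eq_bigr => s _; rewrite /= !mulrDr.
Qed.

(** Each moment is g_c = c! q_c with q_c the coefficient of the form. The c! cancel the denominator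
    \lambda!, and (-1)^l splits into one sign per column, which leaves divided powers of - q_c. *)
Lemma meval_neg_bell_moment (x : 'rV[R]_n) i :
  meval (fun r => f (x 0 r)) (neg_bell_moment (moment E mu_x) i) =
  f (quad_bell Q i x).
Proof.
rewrite /quad_bell /bell_sum rmorphM (rmorph_sum f) big_distrr /=.
rewrite raddf_sum big_seq [RHS]big_seq /=; apply: eq_bigr => l li.
have l0 : 0%MM \notin l by move: li; rewrite mem_mparts => /and3P[].
rewrite mevalZ mevalM rmorphXn /= rmorphN1.
have -> : meval (fun r => f (x 0 r))
    (\prod_(c <- undup l) moment E mu_x c ^+ count_mem c l) =
    \prod_(c <- undup l) f ((mfact c)%:R * quad_coef Q x c) ^+ count_mem c l.
  rewrite rmorph_prod; apply: eq_big_seq => c; rewrite mem_undup => cl /=.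
  by rewrite rmorphXn /= meval_moment_shift //; apply: contraNneq l0 => <-.
have -> : (-1) ^+ size l = \prod_(c <- undup l) (-1) ^+ count_mem c l :> K.
  transitivity (\prod_(c <- l) (-1) : K).
    by rewrite big_const_seq count_predT iter_mulr_1.
  by rewrite -big_undup_iterop_count.
rewrite (rmorph_nat f) !natr_prod -mulrA; congr (_ * _).
rewrite -!big_split /= -prodfV -big_split /part_weight (rmorph_prod f) /=.
apply: eq_bigr => c _.
have fc : (mfact c)%:R != 0 :> K.
  by rewrite -(rmorph_nat f) fmorph_eq0 pnatr_eq0 -lt0n mfact_gt0.
rewrite natrX fmorph_div rmorphXn rmorph_nat rmorphN rmorphM rmorph_nat.
set q := f (quad_coef Q x c); set k := count_mem c l.
have kn : k`!%:R != 0 :> K.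
  by rewrite -(rmorph_nat f) fmorph_eq0 pnatr_eq0 -lt0n fact_gt0.
rewrite exprMn [(- q) ^+ k]exprNn; field.
by rewrite kn expf_neq0.
Qed.

End Umbral.

(** * Hermite polynomials as Bell polynomials, and the conclusion *)

Lemma hermiteE (R : realType) n (i : multinom n) (x : 'rV[R]_n)
  (Sigma : 'M[R]_n) : covariance_matrix Sigma -> \rank Sigma = n ->
  hermite i x Sigma = (-1) ^+ mdeg i * quad_bell (invmx Sigma) i x.
Proof.
move=> cov rk; have det_gt0 := cov_det_gt0 cov rk; have [symS _] := cov.
have symQ : (invmx Sigma)^T = invmx Sigma by rewrite trmx_inv symS.
pose g (y : 'rV[R]_n) := expR (- 2^-1 * (y *m invmx Sigma *m y^T) 0 0).
pose k := (Num.sqrt ((2 * pi) ^+ n * \det Sigma))^-1.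
have gaussE : gauss_density 0 Sigma = k *: g.
  by apply/funext => y; rewrite /gauss_density subr0.
(* [Num.sqrt] is 0 at nonpositive arguments and the inverse of 0 is 0, so the positivity of the
   determinant is what allows dividing by the density. *)
have k_neq0 : k != 0.
  rewrite invr_neq0 // gt_eqF // sqrtr_gt0 mulr_gt0 // exprn_gt0 //.
  by rewrite mulr_gt0 // pi_gt0.
have dg y r : is_derive y (delta_mx 0 r : 'rV[R]_n) (gauss_density 0 Sigma)
    (- (y *m invmx Sigma) 0 r * gauss_density 0 Sigma y).
  have := is_derive_expR_form symQ y r; rewrite -/g gaussE => D.
  by apply: is_derive_eq; rewrite -[LHS]/(_ * _) -[(k *: g) y]/(k * g y) mulrCA.
rewrite /hermite (mpartial_expR_form symQ _ dg) mulrA mulfK // gaussE.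
by rewrite mulf_neq0 // gt_eqF // expR_gt0.
Qed.

(* A finite extension K of the reals is, up to isomorphism, the real or the
   complex field. *)
Theorem proposition4p3 (R : realType) (K : fieldExtType R) (n : nat)
  (A : choiceType) (E : {scalar {umbral {mpoly K[n]}[A]}})
  (hE : is_evaluation E)
  (Sigma : 'M[R]_n) (hSigma : covariance_matrix Sigma)
  (hrank : \rank Sigma = n)
  (mu mu_x : 'I_n -> {umbral {mpoly K[n]}[A]})
  (hmu : genfun E mu (tvars K n) =
     poly_xtseries
       (1 + real_const K n 2^-1 *
          (tvars K n *m map_mx (real_const K n) (invmx Sigma)
           *m (tvars K n)^T) 0 0))
  (hmu_x : genfun E mu_x (tvars K n) =
     poly_xtseries 1 + genfun E mu (tvars K n + xvars K n)
     - genfun E mu (xvars K n))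
  (i : multinom n) (x : 'rV[R]_n) :
  (hermite i x Sigma)%:A =
  meval (fun r => (x 0 r)%:A)
    ((-1) ^+ mdeg i * neg_bell_moment (moment E mu_x) i).
Proof.
have [symS _] := hSigma.
have symQ : (invmx Sigma)^T = invmx Sigma by rewrite trmx_inv symS.
rewrite hermiteE // mevalM rmorphXn /= rmorphN1.
(* The scalar embedding [in_alg K] of the reals plays the part of the morphism [f]. *)
have -> := @meval_neg_bell_moment _ _ (in_alg K) _ _ E mu mu_x _ symQ hmu hmu_x x i.
by rewrite -[LHS]/(in_alg K _) rmorphM rmorphXn rmorphN1.
Qed.
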